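(* Let $T$ be a tree with diameter $d$ and domination number $\gamma$. Then $\gamma=(d+1)/3$ if and only if $m_T[0,1)=(d+1)/3$.
   Context: For a graph $G$, the Laplacian matrix is $L(G)=D(G)-A(G)$ (degree diagonal matrix minus adjacency matrix), and $m_G[0,1)$ denotes the number of eigenvalues of $L(G)$, counted with multiplicity, lying in $[0,1)$. A dominating set of $G$ is a set $S\subseteq V(G)$ such that every vertex not in $S$ is adjacent to a vertex of $S$; the domination number $\gamma$ is the minimum size of a dominating set. *)

(* Defs.v *)
From mathcomp Require Import all_boot all_order all_algebra polyrcf.

Set Implicit Arguments.
Unset Strict Implicit.
Unset Printing Implicit Defensive.

Import Order.TTheory GRing.Theory Num.Theory.
Local Open Scope ring_scope.

Section Graph.
Variables (T : finType) (e : rel T).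

Definition simple_graph : Prop := symmetric e /\ irreflexive e.

(* [ucycle e [:: x; y]] holds for every edge xy; genuine cycles have at least *)
(* three vertices.                                                            *)
Definition acyclic : Prop := forall c : seq T, ucycle e c -> (size c < 3)%N.

Definition connected : Prop :=
  (0 < #|T|)%N /\ forall x y : T, connect e x y.

Definition tree : Prop := [/\ simple_graph, connected & acyclic].

Definition walk_of_length (x y : T) (n : nat) : bool :=
  [exists p : n.-tuple T, path e x p && (last x p == y)].

(* A shortest walk has fewer than #|T| edges; if x and y lie in different     *)
(* components, [find] returns the default #|T|.                               *)
Definition dist (x y : T) : nat := find (walk_of_length x y) (iota 0 #|T|).

Definition diameter : nat := (\max_(x : T) \max_(y : T) dist x y)%N.

Definition dominating (S : {set T}) : bool :=
  [forall x, (x \notin S) ==> [exists y in S, e x y]].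

(* [setT] is dominating, so the minimum is over a nonempty family.            *)
Definition domination_number : nat :=
  #|[arg min_(S < [set: T] | dominating S) #|S|]%N|.

Definition degree (x : T) : nat := #|[set y | e x y]|.

Variable R : rcfType.

Definition adjacency_mx : 'M[R]_#|T| :=
  \matrix_(i, j) (e (enum_val i) (enum_val j))%:R.

Definition degree_mx : 'M[R]_#|T| :=
  diag_mx (\row_i (degree (enum_val i))%:R).

Definition laplacian_mx : 'M[R]_#|T| := degree_mx - adjacency_mx.

End Graph.

(* [rootsR] lists each root once, so multiplicities are added back by [mup].  *)
Definition eigenvalue_count (R : rcfType) (n : nat) (A : 'M[R]_n)
    (I : interval R) : nat :=
  (\sum_(a <- rootsR (char_poly A) | a \in I) mup a (char_poly A))%N.

(* Main.v *)
From HB Require Import structures.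
Require Import Defs.
From mathcomp Require Import all_boot all_order all_algebra.
From mathcomp Require Import polyrcf complex ring lra zify.

(**
Let q(x) = sum_(uv edge) (x_u - x_v)^2 - sum_v x_v^2 be the form of L - 1; the
number m of eigenvalues in [0, 1) is its negative index.

If D dominates, q >= 0 on the vectors vanishing on D, hence m <= gamma.

Conversely let d + 1 = 3k and let v_0, ..., v_(3k-1) be a diametral path.
Taking b_j = x(v_(3j+1)) free and x(v_(3j+2)) = x(v_(3j+3)) = 2 b_j - x(v_(3j))
gives a space of vectors on the path where q = -3 sum_j b_j^2, with x(v_0)
free. A vector on a subtree S extends to the whole tree by a retraction onto S, which
does not increase q, so m >= k. If the vertices v_(3j+1) do not dominate, then
either some vertex off the path is adjacent to a v_i with i <> 1 mod 3, and
giving it the value x(v_i) adds the term - x(v_i)^2, which also makes the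
direction of x(v_0) negative; or a path of two edges hangs from some v_(3j+1),
and its two outer vertices may carry a further free value. In both cases
m >= k + 1. So m = k forces gamma <= k, while k <= m <= gamma always holds.
*)

Set Implicit Arguments.
Unset Strict Implicit.
Unset Printing Implicit Defensive.

Import Order.TTheory GRing.Theory Num.Theory.
Local Open Scope ring_scope.

(** * Hermitian forms in a unitary eigenbasis *)

Section HermitianForm.
Variable C : numClosedFieldType.
Local Open Scope sesquilinear_scope.

Definition hform n (A : 'M[C]_n) (z : 'rV[C]_n) : C := (z *m A *m z^t*) 0 0.

Lemma hform_unitary_diag n (U : 'M[C]_n) (d : 'rV[C]_n) (z : 'rV[C]_n) :
  hform (U^t* *m diag_mx d *m U) z = \sum_i d 0 i * `|(z *m U^t*) 0 i| ^+ 2.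
Proof.
rewrite /hform; pose w := z *m U^t*.
have -> : z *m (U^t* *m diag_mx d *m U) *m z^t* = w *m diag_mx d *m w^t*.
  by rewrite /w trmx_mul map_mxM trmxCK !mulmxA.
rewrite mxE; apply: eq_bigr => i _.
by rewrite mul_mx_diag !mxE normCK; ring.
Qed.

End HermitianForm.

(** * Spectral theorem and inertia for real symmetric matrices *)

Section Spectral.
Variable R : rcfType.
Local Notation C := R[i].
Local Notation toC := (map_mx (real_complex R)).
Local Open Scope sesquilinear_scope.

Definition qform n (A : 'M[R]_n) (x : 'rV[R]_n) : R := (x *m A *m x^T) 0 0.

(** For z = a + ib the two cross terms are opposite because A is symmetric, so only the forms at a
    and b remain. This carries sign conditions from real vectors to complex ones. *)
Lemma hform_real n (A : 'M[R]_n) (z : 'rV[C]_n) : A^T = A ->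
  hform (toC A) z
  = (qform A (map_mx (@complex.Re R) z) + qform A (map_mx (@complex.Im R)
    z))%:C%C.
Proof.
move=> symA; set a := map_mx _ z; set b := map_mx (@complex.Im R) z.
have zE : z = toC a + 'i%C *: toC b.
  by apply/matrixP=> i j; rewrite !mxE [LHS]complexE.
have zE' : z^t* = toC a^T - 'i%C *: toC b^T.
  apply/matrixP=> i j; rewrite !mxE /=.
  by case: (z j i) => u v /=; apply/eqP; rewrite eq_complex /=; apply/andP;
    split; apply/eqP; ring.
have sab : (b *m A *m a^T) = (a *m A *m b^T).
  have -> : a *m A *m b^T = (b *m A *m a^T)^T.
    by rewrite !trmx_mul !trmxK symA mulmxA.
  by apply/matrixP=> i j; rewrite !ord1 [RHS]mxE.
rewrite /hform /qform {1}zE zE' mulmxDl !mulmxBr !mulmxDl -!scalemxAl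
  -!scalemxAr -!map_mxM.
rewrite scalerA sab -expr2 sqr_i.
move: (a *m A *m a^T) (a *m A *m b^T) (b *m A *m b^T) => X Y Z.
rewrite !mxE rmorphD /=; ring.
Qed.

(** The complexification of A is Hermitian, so the complex spectral theorem applies and its
    eigenvalues are real; the eigenbasis U stays complex. *)
Lemma real_symmetric_spectral n (A : 'M[R]_n) : A^T = A ->
  exists (U : 'M[C]_n) (r : 'rV[R]_n),
    U \is unitarymx /\ toC A = U^t* *m diag_mx (toC r) *m U.
Proof.
move=> symA.
have Aherm : toC A \is hermsymmx.
  apply: realsym_hermsym.
    apply/is_hermitianmxP; rewrite expr0 scale1r map_mx_id //.
    by rewrite map_trmx symA.
  by apply/mxOverP=> i j; rewrite mxE; apply/complex_realP; exists (A i j).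
have /orthomx_spectralP AE := hermitian_normalmx Aherm.
have /mxOverP dR := hermitian_spectral_diag_real Aherm.
move: (spectralmx _) (spectral_diag _) (spectral_unitarymx (toC A)) AE dR.
move=> U d Uu AE dR; exists U, (map_mx (@complex.Re R) d); split=> //.
have -> : toC (map_mx (@complex.Re R) d) = d.
  by apply/matrixP=> i j; rewrite !mxE RRe_real.
by rewrite -(invmx_unitary Uu).
Qed.


Lemma char_poly_similar (F : comNzRingType) n (V D U : 'M[F]_n) :
  V *m U = 1%:M -> char_poly (V *m D *m U) = char_poly D.
Proof.
move=> VU; rewrite /char_poly.
have pVU : map_mx polyC V *m map_mx polyC U = 1%:M.
  by rewrite -map_mxM VU map_mx1.
have -> : char_poly_mx (V *m D *m U)
  = map_mx polyC V *m char_poly_mx D *m map_mx polyC U.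
  rewrite /char_poly_mx mulmxBr mulmxBl -!map_mxM; congr (_ - _).
  by rewrite mul_mx_scalar -scalemxAl pVU scalemx1.
by rewrite !det_mulmx mulrAC -det_mulmx pVU det1 mul1r.
Qed.

Lemma char_poly_spectral n (A : 'M[R]_n) (U : 'M[C]_n) (r : 'rV[R]_n) :
  U \is unitarymx -> toC A = U^t* *m diag_mx (toC r) *m U ->
  char_poly A = \prod_i ('X - (r 0 i)%:P).
Proof.
move=> Uu AE; apply: (map_poly_inj (real_complex R)).
rewrite map_char_poly AE char_poly_similar; last first.
  by rewrite -(invmx_unitary Uu) mulVmx ?unitarymx_unit.
rewrite char_poly_trig ?diag_mx_is_trig // rmorph_prod; apply: eq_bigr => i _.
by rewrite rmorphB /= map_polyX map_polyC !mxE eqxx.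
Qed.

(** Meant for t the distinct roots and s the eigenvalues with repetition: a sum of multiplicities
    becomes a count of indices. *)
Lemma sum_count_mem (K : eqType) (P : pred K) (t s : seq K) :
  uniq t -> {subset s <= t} ->
  (\sum_(a <- t | P a) count_mem a s)%N = count P s.
Proof.
move=> t_uniq; elim: s => [|y s IHs] st /=; first by rewrite big1.
rewrite big_split /= IHs; last by move=> z zs; rewrite st // in_cons zs orbT.
congr (_ + _)%N; rewrite (bigID (pred1 y)) /= [X in (_ + X)%N]big1 ?addn0.
  rewrite (eq_bigr (fun=> 1%N)); last by move=> a /andP[_ /eqP->]; rewrite eqxx.
  rewrite sum1_count -(eq_count (a1 := predI P (pred1 y))) //.
  have ty : y \in t by rewrite st // mem_head.
  have -> : count (predI P (pred1 y)) t = count (predI (pred1 y) (fun=> P y)) t.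
    by apply: eq_count => a /=; case: eqVneq => [->|]; rewrite ?andbT ?andbF.
  case: (P y) => /=; last first.
    by rewrite (eq_count (a2 := pred0)) ?count_pred0 // => a /=; rewrite andbF.
  rewrite (eq_count (a2 := pred1 y)) ?count_uniq_mem ?ty // => a /=.
  by rewrite andbT.
by move=> a /andP[_ /negbTE]; rewrite eq_sym => ->.
Qed.

Lemma eigenvalue_count_prod n (A : 'M[R]_n) (r : 'rV[R]_n) (I : interval R) :
  char_poly A = \prod_i ('X - (r 0 i)%:P) ->
  eigenvalue_count A I = #|[set i | r 0 i \in I]|.
Proof.
move=> pE; rewrite /eigenvalue_count.
pose s := [seq r 0 i | i <- index_enum 'I_n].
have {}pE : char_poly A = \prod_(y <- s) ('X - y%:P) by rewrite pE big_map.
rewrite (eq_bigr (fun a => count_mem a s)); last first.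
  by move=> a _; rewrite pE mu_prod_XsubC.
rewrite sum_count_mem.
- rewrite -sum1_count big_map -sum1_card.
  by apply: eq_bigl => i; rewrite inE.
- exact: uniq_roots.
move=> a sa; have p0 : char_poly A != 0 by rewrite monic_neq0 ?char_poly_monic.
by rewrite -roots_on_rootsR // in_itv /= pE root_prod_XsubC.
Qed.

Lemma hform_spectral n (A : 'M[R]_n) (U : 'M[C]_n) (r : 'rV[R]_n) t z :
  U \is unitarymx -> toC A = U^t* *m diag_mx (toC r) *m U ->
  hform (toC (A - t%:M)) z
  = \sum_i (r 0 i - t)%:C%C * `|(z *m U^t*) 0 i| ^+ 2.
Proof.
move=> Uu AE.
have -> : toC (A - t%:M) = U^t* *m diag_mx (toC (r - const_mx t)) *m U.
  rewrite map_mxB AE map_mxB raddfB /= mulmxBr mulmxBl; congr (_ - _).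
  rewrite map_const_mx diag_const_mx map_scalar_mx /= -scalemx1 -scalemxAr
    -scalemxAl.
  by rewrite mulmx1 -(invmx_unitary Uu) mulVmx ?unitarymx_unit.
rewrite hform_unitary_diag; apply: eq_bigr => i _.
by rewrite !mxE.
Qed.

Lemma left_kernel_vector (F : fieldType) m n (B : 'M[F]_(m, n)) : (n < m)%N ->
  exists2 c : 'rV[F]_m, c != 0 & c *m B = 0.
Proof.
move=> ltnm; have : kermx B != 0.
  rewrite -mxrank_eq0 mxrank_ker -lt0n subn_gt0.
  exact: leq_ltn_trans (rank_leq_col B) ltnm.
by move=> /rowV0Pn[c /sub_kermxP cB c0]; exists c.
Qed.

Lemma hform_lt0 n (A : 'M[R]_n) (t : R) (z : 'rV[C]_n) : A^T = A ->
  (hform (toC (A - t%:M)) z < 0)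
  = (qform (A - t%:M) (map_mx (@complex.Re R) z)
     + qform (A - t%:M) (map_mx (@complex.Im R) z) < 0).
Proof.
move=> symA; rewrite hform_real ?ltcR //.
by rewrite raddfB /= symA tr_scalar_mx.
Qed.

(** If m exceeded the number of eigenvalues below t, some nonzero combination of the rows of M would
    be orthogonal to all their eigenvectors, and the form would be nonnegative there. The
    combination is complex since U is, but its real and imaginary parts lie in the real row space
    and one has a nonzero coefficient vector. *)
Lemma negative_subspace_le n (A : 'M[R]_n) (U : 'M[C]_n) (r : 'rV[R]_n)
    (t : R) m (M : 'M[R]_(m, n)) :
  A^T = A -> U \is unitarymx -> toC A = U^t* *m diag_mx (toC r) *m U ->
  (forall c : 'rV[R]_m, c != 0 -> qform (A - t%:M) (c *m M) < 0) ->
  (m <= #|[set i | (r 0 i < t)%R]|)%N.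
Proof.
move=> symA Uu AE Mneg; rewrite leqNgt; apply/negP; set J :=
  [set i | _] => ltJm.
have [c c0 cB] := left_kernel_vector
  (colsub (enum_val : 'I_#|J| -> 'I_n) (toC M *m U^t*)) ltJm.
set a := map_mx (@complex.Re R) c; set b := map_mx (@complex.Im R) c.
have ab0 : (a != 0) || (b != 0).
  rewrite -negb_and; apply: contraNN c0 => /andP[/eqP a0 /eqP b0].
  apply/eqP/rowP=> i; move/rowP/(_ i): b0; move/rowP/(_ i): a0.
  by rewrite !mxE; case: (c 0 i) => u v /= -> ->.
have q_le0 d : qform (A - t%:M) (d *m M) <= 0.
  have [->|d0] := eqVneq d 0; last exact/ltW/Mneg.
  by rewrite /qform !mul0mx mxE.
have : hform (toC (A - t%:M)) (c *m toC M) < 0.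
  rewrite hform_lt0 //.
  have -> : map_mx (@complex.Re R) (c *m toC M) = a *m M.
    apply/matrixP=> i j; rewrite !mxE raddf_sum; apply: eq_bigr => k _.
    by rewrite !mxE /=; case: (c i k) => x y /=; ring.
  have -> : map_mx (@complex.Im R) (c *m toC M) = b *m M.
    apply/matrixP=> i j; rewrite !mxE raddf_sum; apply: eq_bigr => k _.
    by rewrite !mxE /=; case: (c i k) => x y /=; ring.
  case/orP: ab0 => /Mneg; have := q_le0 a; have := q_le0 b; lra.
apply/negP; rewrite le_gtF // (hform_spectral _ _ Uu AE);
  apply: sumr_ge0 => i _.
have [iJ|] := boolP (i \in J); last first.
  by rewrite inE -leNgt => ti; rewrite mulr_ge0 ?exprn_ge0 // ler0c subr_ge0.
suff -> : (c *m toC M *m U^t*) 0 i = 0 by rewrite normr0 expr0n mulr0.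
move/rowP/(_ (enum_rank_in iJ i)): cB.
by rewrite -mulmxA mulmx_colsub mxE enum_rankK_in // => ->; rewrite mxE.
Qed.

(** Dual dimension count: if the eigenvectors for eigenvalues below t outnumbered D, a nonzero
    combination z of them would vanish on D. Its eigenbasis coordinates are c on J and 0 elsewhere,
    so the form is negative at z, against nonnegativity at its real and imaginary parts. *)
Lemma nonneg_subspace_ge n (A : 'M[R]_n) (U : 'M[C]_n) (r : 'rV[R]_n)
    (t : R) (D : {set 'I_n}) :
  A^T = A -> U \is unitarymx -> toC A = U^t* *m diag_mx (toC r) *m U ->
  (forall x : 'rV[R]_n, (forall i, i \in D -> x 0 i = 0) ->
     0 <= qform (A - t%:M) x) ->
  (#|[set i | (r 0 i < t)%R]| <= #|D|)%N.
Proof.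
move=> symA Uu AE Dpos; rewrite leqNgt; apply/negP; set J :=
  [set i | _] => ltDJ.
pose UJ := rowsub (enum_val : 'I_#|J| -> 'I_n) U.
have [c c0 cB] := left_kernel_vector (colsub (enum_val : 'I_#|D| ->
  'I_n) UJ) ltDJ.
pose z := c *m UJ.
have zD i : i \in D -> z 0 i = 0.
  move=> iD; move/rowP/(_ (enum_rank_in iD i)): cB.
  by rewrite mulmx_colsub mxE enum_rankK_in // => ->; rewrite mxE.
have zU : z *m U^t* = c *m rowsub (enum_val : 'I_#|J| -> 'I_n) 1%:M.
  rewrite /z -mulmxA /UJ mul_rowsub_mx; congr (_ *m rowsub _ _).
  exact/unitarymxP.
have : 0 <= hform (toC (A - t%:M)) z.
  rewrite hform_real; last by rewrite raddfB /= symA tr_scalar_mx.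
  rewrite ler0c addr_ge0 // Dpos // => i iD; rewrite mxE zD //.
apply/negP; rewrite lt_geF // (hform_spectral _ _ Uu AE) zU.
set w := c *m _.
have wE j : w 0 (enum_val j) = c 0 j.
  rewrite mxE (bigD1 j) //= !mxE eqxx mulr1 big1 ?addr0 // => k kj.
  by rewrite !mxE (inj_eq enum_val_inj) (negbTE kj) mulr0.
have w0 i : i \notin J -> w 0 i = 0.
  move=> iJ; rewrite mxE big1 // => k _; rewrite !mxE.
  by case: eqP => [ki|]; rewrite ?mulr0 //; move: iJ; rewrite -ki enum_valP.
have term_le0 i : (r 0 i - t)%:C%C * `|w 0 i| ^+ 2 <= 0.
  have [iJ|iJ] := boolP (i \in J); last by rewrite w0 // normr0 expr0n mulr0.
  rewrite mulr_le0_ge0 ?exprn_ge0 // -(rmorph0 (real_complex R)) lecR.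
  by rewrite subr_le0 ltW //; move: iJ; rewrite inE.
have /rV0Pn[j cj0] := c0.
rewrite (bigD1 (enum_val j)) //= -[ltRHS]addr0.
apply: ltr_leD; last exact: sumr_le0.
rewrite wE nmulr_rlt0 ?exprn_gt0 ?normr_gt0 //.
rewrite -(rmorph0 (real_complex R)) ltcR subr_lt0.
by have := enum_valP j; rewrite inE.
Qed.

End Spectral.

(** * Bounds on the number of eigenvalues in [0, t) *)

Section CountBounds.
Variable R : rcfType.

Lemma eigenvalue_count_lt n (A : 'M[R]_n) (r : 'rV[R]_n) U t :
  A^T = A -> U \is unitarymx ->
  map_mx (real_complex R) A
    = (map_mx Num.conj U^T) *m diag_mx (map_mx (real_complex R) r) *m U ->
  (forall x, 0 <= qform A x) ->
  eigenvalue_count A `[0, t[ = #|[set i | (r 0 i < t)%R]|.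
Proof.
move=> symA Uu AE psdA.
rewrite (eigenvalue_count_prod _ (char_poly_spectral Uu AE)).
(* The case t = 0 and D empty: a positive semidefinite matrix has no negative eigenvalue. *)
have : (#|[set i | (r 0 i < 0)%R]| <= #|set0 : {set 'I_n}|)%N.
  by apply: (nonneg_subspace_ge symA Uu AE) => x _;
    rewrite (raddf0 (@scalar_mx R n)) subr0.
rewrite cards0 leqn0 cards_eq0 => /eqP neg0.
apply: eq_card => i; rewrite [LHS]inE [RHS]inE in_itv /=.
have : i \notin [set i | (r 0 i < 0)%R] by rewrite neg0 inE.
by rewrite inE -leNgt => ->.
Qed.

(** The negative subspace is given by a linear parametrization; negativity off 0 makes it injective,
    so its image has dimension m. *)
Lemma eigenvalue_count_ge n (A : 'M[R]_n) t m (F : 'rV[R]_m -> 'rV[R]_n) :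
  A^T = A -> (forall x, 0 <= qform A x) -> linear F ->
  (forall c, c != 0 -> qform (A - t%:M) (F c) < 0) ->
  (m <= eigenvalue_count A `[0%R, t[)%N.
Proof.
move=> symA psdA Flin Fneg.
have [U [r [Uu AE]]] := real_symmetric_spectral symA.
rewrite (eigenvalue_count_lt _ symA Uu AE psdA).
pose FL : {linear 'rV[R]_m -> 'rV[R]_n} :=
  HB.pack F (GRing.isLinear.Build _ _ _ _ F Flin).
apply: (negative_subspace_le (M := lin1_mx FL) symA Uu AE) => c c0.
by rewrite mul_rV_lin1; exact: Fneg.
Qed.

Lemma eigenvalue_count_le n (A : 'M[R]_n) t (D : {set 'I_n}) :
  A^T = A -> (forall x, 0 <= qform A x) ->
  (forall x : 'rV[R]_n, (forall i, i \in D -> x 0 i = 0) ->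
     0 <= qform (A - t%:M) x) ->
  (eigenvalue_count A `[0%R, t[ <= #|D|)%N.
Proof.
move=> symA psdA Dpos.
have [U [r [Uu AE]]] := real_symmetric_spectral symA.
rewrite (eigenvalue_count_lt _ symA Uu AE psdA).
exact: (nonneg_subspace_ge symA Uu AE).
Qed.

End CountBounds.

(** * The quadratic form of the Laplacian and dominating sets *)

Section GraphForm.
Variables (R : rcfType) (T : finType) (e : rel T).
Hypothesis e_sym : symmetric e.
Implicit Types (S : {set T}) (x : T -> R).

(** The sum runs over ordered pairs, so each edge counts twice. *)
Definition energy S x : R :=
  \sum_(u in S) \sum_(v in S) (e u v)%:R * (x u - x v) ^+ 2.

(* Twice the form of [L - 1] on the subgraph induced by [S]. *)
Definition lap_form S x : R := energy S x - 2 * \sum_(u in S) x u ^+ 2.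

Lemma energy_ge0 S x : 0 <= energy S x.
Proof.
by do 2!apply: sumr_ge0 => ? _; rewrite mulr_ge0 ?sqr_ge0 ?ler0n.
Qed.

Lemma laplacian_sym : (laplacian_mx e R)^T = laplacian_mx e R.
Proof.
apply/matrixP=> i j; rewrite !mxE e_sym; congr (_ - _).
by rewrite eq_sym; case: eqVneq => [->|].
Qed.

Lemma sum_enum_val (F : T -> R) : \sum_(i < #|T|) F (enum_val i) = \sum_u F u.
Proof.
rewrite (reindex (@enum_rank T)); last exact/onW_bij/enum_rank_bij.
by apply: eq_bigr => u _; rewrite enum_rankK.
Qed.

Lemma sum_setT (F : T -> R) : \sum_(u in [set: T]) F u = \sum_u F u.
Proof. by apply: eq_bigl => u; rewrite inE. Qed.

Lemma degreeE u : (degree e u)%:R = \sum_v (e u v)%:R :> R.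
Proof.
rewrite /degree -sum1_card natr_sum big_mkcond; apply: eq_bigr => v _.
by rewrite inE; case: (e u v).
Qed.

Lemma qform_laplacian x :
  2 * qform (laplacian_mx e R) (\row_i x (enum_val i)) = energy setT x.
Proof.
have -> : qform (laplacian_mx e R) (\row_i x (enum_val i)) =
    \sum_u \sum_v ((e u v)%:R * x u ^+ 2 - (e u v)%:R * x u * x v).
  rewrite /qform mxE -sum_enum_val; apply: eq_bigr => i _.
  rewrite !mxE mulr_suml.
  rewrite (eq_bigr (fun j => (degree e (enum_val i))%:R *+ (i == j)
     * x (enum_val i) ^+ 2 - (e (enum_val i) (enum_val j))%:R * x (enum_val i)
       * x (enum_val j))); last first.
    move=> j _; rewrite !mxE e_sym [j == i]eq_sym; case: eqVneq => [->|_] /=;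
      ring.
  rewrite sumrB [RHS]sumrB -mulr_suml; congr (_ - _).
    rewrite (bigD1 i) //= eqxx mulr1n big1 ?addr0 ?degreeE -?mulr_suml // => j.
    by rewrite eq_sym => /negbTE->.
  by rewrite (sum_enum_val (fun v => (e (enum_val i) v)%:R * x (enum_val i) *
    x v)).
(* Exchanging u and v in one of the two copies completes the squares. *)
rewrite mulr_natl mulr2n {1}exchange_big -big_split /=.
rewrite /energy sum_setT; apply: eq_bigr => u _.
rewrite sum_setT -big_split /=; apply: eq_bigr => v _.
by rewrite e_sym; ring.
Qed.

Lemma qform_laplacian_ge0 (y : 'rV[R]_#|T|) : 0 <= qform (laplacian_mx e R) y.
Proof.
have -> : y = \row_i (y 0 (enum_rank (enum_val i))).
  by apply/rowP=> i; rewrite mxE enum_valK.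
rewrite -(pmulr_rge0 _ (ltr0n _ 2)).
by rewrite (qform_laplacian (fun u => y 0 (enum_rank u))) energy_ge0.
Qed.

Lemma qform_laplacianB1 x :
  2 * qform (laplacian_mx e R - 1%:M) (\row_i x (enum_val i)) = lap_form setT x.
Proof.
rewrite /qform mulmxBr mulmxBl mulmx1 /lap_form -qform_laplacian -mulrBr.
congr (2 * _).
pose y : 'rV[R]_#|T| := \row_i x (enum_val i).
have -> : \sum_(u in setT) x u ^+ 2 = (y *m y^T) 0 0.
  rewrite mxE sum_setT -sum_enum_val; apply: eq_bigr => i _.
  by rewrite !mxE expr2.
by rewrite /qform [LHS]mxE; congr (_ + _); rewrite [LHS]mxE.
Qed.

(** A vertex u outside D has a neighbour in D, where x vanishes, so that edge contributes x u ^+ 2.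
    It occurs in both orientations, which pays for the factor 2. *)
Lemma lap_form_ge0 D x : dominating e D -> {in D, forall u, x u = 0} ->
  0 <= lap_form setT x.
Proof.
move=> /forallP Ddom xD; rewrite /lap_form /energy subr_ge0.
have hin u : u \notin D -> x u ^+ 2 <= \sum_(v in D) (e u v)%:R * (x u - x v)
  ^+ 2.
  move=> uD; have /implyP/(_ uD)/existsP[v /andP[vD euv]] := Ddom u.
  rewrite (bigD1 v) //= euv mul1r (xD v vD) subr0 lerDl.
  by apply: sumr_ge0 => ? _; rewrite mulr_ge0 ?sqr_ge0 ?ler0n.
have sumE : \sum_(u in [set: T]) x u ^+ 2 = \sum_(u | u \notin D) x u ^+ 2.
  rewrite sum_setT (bigID (mem D)) /= big1 ?add0r //.
  by move=> u uD; rewrite xD // expr0n.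
have half : \sum_(u | u \notin D) x u ^+ 2
    <= \sum_(u | u \notin D) \sum_(v in D) (e u v)%:R * (x u - x v) ^+ 2.
  by apply: ler_sum => u uD; exact: hin.
have half' : \sum_(u | u \notin D) x u ^+ 2
    <= \sum_(u in D) \sum_(v | v \notin D) (e u v)%:R * (x u - x v) ^+ 2.
  rewrite exchange_big /= (le_trans half) //; apply: ler_sum => u _.
  by apply: ler_sum => v _; rewrite e_sym -sqrrN opprB.
(* The energy is split by whether the first endpoint lies in D; each half bounds one copy of the sum
   of squares. *)
rewrite sumE mulr_natl mulr2n sum_setT [leRHS](bigID (mem D)) /=.
apply: lerD; first rewrite (le_trans half') //; last first.
  rewrite (le_trans half) //.
  apply: ler_sum => u uD; rewrite sum_setT [leRHS](bigID (mem D)) /= lerDl.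
  by apply: sumr_ge0 => ? _; rewrite mulr_ge0 ?sqr_ge0 ?ler0n.
apply: ler_sum => u uD; rewrite sum_setT [leRHS](bigID (mem D)) /= lerDr.
by apply: sumr_ge0 => ? _; rewrite mulr_ge0 ?sqr_ge0 ?ler0n.
Qed.

Lemma eigenvalue_count_le_dominating D : dominating e D ->
  (eigenvalue_count (laplacian_mx e R) `[0%R, 1%R[ <= #|D|)%N.
Proof.
move=> Ddom; rewrite -(card_imset (mem D) (@enum_rank_inj T)).
apply: eigenvalue_count_le;
  [exact: laplacian_sym | exact: qform_laplacian_ge0 |].
move=> y yD; have yE : y = \row_i (y 0 (enum_rank (enum_val i))).
  by apply/rowP=> i; rewrite mxE enum_valK.
rewrite yE -(pmulr_rge0 _ (ltr0n _ 2)) (qform_laplacianB1 (fun u => y 0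
  (enum_rank u))).
apply: (lap_form_ge0 Ddom) => u uD; apply: yD.
exact: imset_f.
Qed.

End GraphForm.

(** * Subtrees, retractions and restriction of the form *)

Section Subtrees.
Variables (T : finType) (e : rel T).
Hypothesis e_tree : tree e.
Implicit Types S : {set T}.

Let e_sym : symmetric e. Proof. by case: e_tree => [[]]. Qed.
Let e_irr : irreflexive e. Proof. by case: e_tree => [[]]. Qed.

Definition induced S : rel T := [rel u v | [&& e u v, u \in S & v \in S]].

Definition subtree S : Prop := {in S &, forall u v, connect (induced S) u v}.

Lemma induced_path S u p : path (induced S) u p -> all (mem S) p.
Proof.
by elim: p u => //= v p IHp u /andP[/and3P[_ _ ->] /IHp].
Qed.

(** Otherwise a simple path inside S from s to s', closed up through t, would be a cycle. *)
Lemma subtree_unique_neighbor S t s s' : subtree S -> t \notin S ->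
  s \in S -> s' \in S -> e t s -> e t s' -> s = s'.
Proof.
move=> Sconn tS sS s'S ets ets'; apply/eqP; apply/negPn/negP => ss'.
have /connectP[p0 /shortenP[p p_path p_uniq _] s'E] := Sconn _ _ sS s'S.
have pS := induced_path p_path.
have {}p_path : path e s p by apply: sub_path p_path => u v /and3P[].
have [_ _ acyc] := e_tree.
have /acyc : ucycle e [:: t, s & p].
  apply/andP; split.
    by rewrite /= ets rcons_path p_path -s'E e_sym.
  rewrite cons_uniq p_uniq andbT inE negb_or.
  apply/andP; split; first by apply: contraNneq tS => ->.
  by apply: contra tS => /(allP pS).
(* As s and s' differ, p is nonempty and the cycle has at least three vertices. *)
by case: p s'E {pS p_path p_uniq} => //= s'E; rewrite s'E eqxx in ss'.
Qed.

Lemma subtreeU1 S t s : subtree S -> s \in S -> e t s -> subtree (t |: S).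
Proof.
move=> Sconn sS ets.
have sub u v : connect (induced S) u v -> connect (induced (t |: S)) u v.
  apply: connect_sub => a b /and3P[eab aS bS].
  by apply: connect1; rewrite /induced /= eab !inE aS bS !orbT.
have ts : connect (induced (t |: S)) t s.
  by apply: connect1; rewrite /induced /= ets !inE eqxx sS orbT.
have st : connect (induced (t |: S)) s t.
  by apply: connect1; rewrite /induced /= e_sym ets !inE eqxx sS orbT.
have toS u : u \in t |: S -> connect (induced (t |: S)) u s.
  by rewrite !inE => /orP[/eqP->//|uS]; apply/sub/Sconn.
have fromS u : u \in t |: S -> connect (induced (t |: S)) s u.
  by rewrite !inE => /orP[/eqP->//|uS]; apply/sub/Sconn.
by move=> u v /toS us /fromS; apply: connect_trans.
Qed.

Lemma subtree1 t : subtree [set t].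
Proof. by move=> u v /set1P-> /set1P->; exact: connect0. Qed.

Lemma boundary_edge S a b : a \in S -> b \notin S ->
  exists s t, [/\ s \in S, t \notin S & e s t].
Proof.
move=> aS bS; have [_ [_ conn] _] := e_tree.
have /connectP[p] := conn a b.
elim: p a aS => [|c p IHp] a aS /=; first by move=> _ bE; rewrite bE aS in bS.
case/andP=> eac pc bE; have [cS|cS] := boolP (c \in S); first exact: (IHp c).
by exists a, c.
Qed.

Section Form.
Variable R : rcfType.
Implicit Types x : T -> R.

Lemma eq_lap_form S x x' : {in S, x =1 x'} ->
  lap_form e S x = lap_form e S x'.
Proof.
move=> xx'; rewrite /lap_form /energy; congr (_ - _ * _).
  by apply: eq_bigr => u uS; apply: eq_bigr => v vS; rewrite !xx'.
by apply: eq_bigr => u uS; rewrite xx'.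
Qed.

(** By uniqueness of the neighbour, adjoining t adds just the edge ts, seen in both orders, and one
    vertex term. *)
Lemma lap_formU1 S t s x : subtree S -> t \notin S -> s \in S -> e t s ->
  lap_form e (t |: S) x
  = lap_form e S x + 2 * (x t - x s) ^+ 2 - 2 * x t ^+ 2.
Proof.
move=> Sconn tS sS ets; rewrite /lap_form /energy !big_setU1 //= e_irr.
have nb : \sum_(v in S) (e t v)%:R * (x t - x v) ^+ 2 = (x t - x s) ^+ 2.
  rewrite (bigD1 s) //= ets mul1r big1 ?addr0 // => v /andP[vS vs].
  case etv: (e t v); rewrite ?mul0r //.
  by rewrite (subtree_unique_neighbor Sconn tS vS sS etv ets) eqxx in vs.
have -> : \sum_(u in S) \sum_(v in t |: S) (e u v)%:R * (x u - x v) ^+ 2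
   = (x t - x s) ^+ 2 + \sum_(u in S) \sum_(v in S) (e u v)%:R * (x u - x v)
     ^+ 2.
  rewrite -nb -big_split /=; apply: eq_bigr => u uS.
  by rewrite big_setU1 //= e_sym -sqrrN opprB.
rewrite nb; ring.
Qed.

(** Induction on the number of vertices outside S: a boundary vertex t is collapsed onto its
    neighbour s. The edge ts then costs nothing, and the new vertex term only lowers the form. *)
Lemma subtree_retraction S a : subtree S -> a \in S ->
  exists2 f : T -> T, {in S, forall u, f u = u}
    & forall x, lap_form e setT (x \o f) <= lap_form e S x.
Proof.
have [n] := ubnP #|~: S|; elim: n S => // n IHn S ltn Sconn aS.
have [ST|] := boolP (S == setT).
  by exists id => // x; rewrite -(eqP ST).
rewrite eqEsubset subsetT /= => /subsetPn[b _ bS].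
have [s [t [sS tS est]]] := boundary_edge aS bS.
have ets : e t s by rewrite e_sym.
have [||f fS f_le] := IHn (t |: S) _ (subtreeU1 Sconn sS ets).
- rewrite -ltnS (leq_trans _ ltn) // ltnS proper_card // setCU.
  rewrite properE subsetIr /=; apply/subsetPn; exists t; rewrite !inE ?eqxx //.
- by rewrite !inE aS orbT.
pose g u := if u == t then s else u.
have gS u : u \in S -> g u = u.
  by rewrite /g; case: eqP => // -> /(negP tS).
have gt : g t = s by rewrite /g eqxx.
exists (g \o f) => [u uS|x]; first by rewrite /= fS ?gS // !inE uS orbT.
apply: (le_trans (f_le (x \o g))).
rewrite (lap_formU1 _ Sconn tS sS ets) /= gt (gS s) //.
rewrite subrr expr0n mulr0 addr0 (@eq_lap_form S (x \o g) x); last first.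
  by move=> u uS /=; rewrite gS.
by rewrite gerDl oppr_le0 mulr_ge0 ?sqr_ge0.
Qed.

Lemma eigenvalue_count_ge_subtree S a m (X : 'rV[R]_m -> T -> R) :
  subtree S -> a \in S ->
  (forall k c d v, X (k *: c + d) v = k * X c v + X d v) ->
  (forall c, c != 0 -> lap_form e S (X c) < 0) ->
  (m <= eigenvalue_count (laplacian_mx e R) `[0%R, 1%R[)%N.
Proof.
move=> Sconn aS Xlin Xneg.
have [f fS f_le] := subtree_retraction Sconn aS.
apply: (@eigenvalue_count_ge _ _ _ _ _
         (fun c => \row_i X c (f (enum_val i)))).
- exact: laplacian_sym.
- exact: qform_laplacian_ge0.
- by move=> k c d; apply/rowP=> i; rewrite !mxE Xlin.
move=> c c0; rewrite -(pmulr_rlt0 _ (ltr0n R 2)).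
rewrite (qform_laplacianB1 e_sym (X c \o f)).
exact: le_lt_trans (f_le _) (Xneg c c0).
Qed.

(** Vertices are appended one at a time at the end of the path. At i = 0 the truncated [i.-1] is 0,
    so the edge term vanishes there. *)
Lemma lap_form_path a p x : path e a p -> uniq (a :: p) ->
  subtree [set v in a :: p] /\
  lap_form e [set v in a :: p] x
  = 2 * \sum_(i < (size p).+1)
      ((x (nth a (a :: p) i) - x (nth a (a :: p) i.-1)) ^+ 2
       - x (nth a (a :: p) i) ^+ 2).
Proof.
elim/last_ind: p => [|p t IHp].
  move=> _ _; rewrite (_ : [set v in [:: a]] = [set a]); last first.
    by apply/setP=> v; rewrite !inE.
  split; first exact: subtree1.
  by rewrite /lap_form /energy !big_set1 e_irr big_ord1 /= !subrr; ring.
rewrite rcons_path -rcons_cons rcons_uniq => /andP[p_path lt] /andP[tp p_uniq].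
have [Sconn SE] := IHp p_path p_uniq.
have -> : [set v in rcons (a :: p) t] = t |: [set v in a :: p].
  by apply/setP=> v; rewrite !inE mem_rcons !inE orbCA.
have lS : last a p \in [set v in a :: p] by rewrite inE mem_last.
have etl : e t (last a p) by rewrite e_sym.
have tS : t \notin [set v in a :: p] by rewrite inE.
split; first exact: subtreeU1 Sconn lS etl.
rewrite (lap_formU1 _ Sconn tS lS etl) {}SE size_rcons [in RHS]big_ord_recr /=.
have -> : nth a (rcons p t) (size p) = t by rewrite nth_rcons ltnn eqxx.
have -> : nth a (a :: rcons p t) (size p) = last a p.
  by rewrite -rcons_cons nth_rcons ltnSn -[size p]/((size (a :: p)).-1)
    nth_last.
rewrite [in RHS](eq_bigr (fun i : 'I_(size p).+1 => ((x (nth a (a :: p) i) - x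
  (nth a (a :: p) i.-1)) ^+ 2
       - x (nth a (a :: p) i) ^+ 2))); first by ring.
move=> i _; rewrite -rcons_cons !nth_rcons /= ltn_ord.
by rewrite (leq_ltn_trans (leq_pred i)).
Qed.

End Form.
End Subtrees.

(** * The test vectors on a path of 3k vertices *)

Section PathVector.
Variable R : rcfType.
Implicit Types (b : nat -> R) (s : R).

Fixpoint alt_seq b s j : R := if j is i.+1 then 2 * b i - alt_seq b s i else s.

(** The quotient [n.+1 %/ 3] is j + 1 at both 3j + 2 and 3j + 3, so these neighbours share a value;
    at n = 0 it is 0, giving s. *)
Definition path_vector b s n : R :=
  if (n %% 3 == 1)%N then b (n %/ 3)%N else alt_seq b s (n.+1 %/ 3)%N.

Lemma path_vector_linear k b b' s s' n :
  path_vector (fun j => k * b j + b' j) (k * s + s') n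
  = k * path_vector b s n + path_vector b' s' n.
Proof.
rewrite /path_vector; case: ifP => // _.
by elim: (_ %/ _)%N => //= j ->; ring.
Qed.

Lemma eq_path_vector b b' s n :
  b =1 b' -> path_vector b s n = path_vector b' s n.
Proof.
move=> bb'; rewrite /path_vector; case: ifP => // _.
by elim: (_ %/ _)%N => //= j ->; rewrite bb'.
Qed.

Lemma path_vector0 b s j : path_vector b s (3 * j)%N = alt_seq b s j.
Proof.
rewrite /path_vector (_ : (3 * j %% 3 == 1)%N = false); last by lia.
by congr alt_seq; lia.
Qed.

Lemma path_vector1 b s j : path_vector b s (3 * j).+1 = b j.
Proof.
rewrite /path_vector (_ : ((3 * j).+1 %% 3 == 1)%N = true); last by lia.
by congr b; lia.
Qed.

Lemma path_vector2 b s j : path_vector b s (3 * j).+2 = alt_seq b s j.+1.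
Proof.
rewrite /path_vector (_ : ((3 * j).+2 %% 3 == 1)%N = false); last by lia.
by congr alt_seq; lia.
Qed.

(* The terms [y_(3j+2) - y_(3j+3)] vanish and each block of three vertices    *)
(* contributes [b_j ^ 2 - 2 b_j (y_(3j) + y_(3j+2)) = - 3 b_j ^ 2].           *)
Lemma path_vector_form b s k : let y := path_vector b s in
  \sum_(i < 3 * k) ((y i - y i.-1) ^+ 2 - y i ^+ 2)
  = - 3 * \sum_(j < k) b j ^+ 2.
Proof.
move=> y; elim: k => [|k IHk]; first by rewrite !big_ord0 mulr0.
rewrite [in RHS]big_ord_recr /= mulnS -[(3 + _)%N]/((3 * k).+3).
rewrite 3!big_ord_recr /= {}IHk /y path_vector0 path_vector1 path_vector2.
(* For k = 0 the truncated predecessor of 0 is 0, so this covers the first block too. *)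
have -> : path_vector b s (3 * k).-1 = alt_seq b s k.
  case: k => [|k]; first exact: path_vector0.
  by rewrite mulnS -[(3 + _).-1]/((3 * k).+2) path_vector2.
rewrite /=; ring.
Qed.

(** Once b vanishes the sequence is s, -s, s, ..., so any of its values detects s. *)
Lemma alt_seq_sqr b s j : (forall i, (i < j)%N -> b i = 0) ->
  alt_seq b s j ^+ 2 = s ^+ 2.
Proof.
elim: j => //= j IHj b0; rewrite b0 // mulr0 sub0r sqrrN IHj // => i ij.
by rewrite b0 // ltnW.
Qed.

(** Extension by zero to all natural indices; with m = k + 1, index k holds the additional free
    parameter. *)
Definition coord m (c : 'rV[R]_m) j : R :=
  if insub j is Some i then c 0 i else 0.

Lemma coord_linear m k (c d : 'rV[R]_m) j :
  coord (k *: c + d) j = k * coord c j + coord d j.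
Proof.
by rewrite /coord; case: insub => [i|]; rewrite ?mxE // mulr0 addr0.
Qed.

Lemma coord_eq0 m (c : 'rV[R]_m) : (forall j, (j < m)%N -> coord c j = 0) ->
  c = 0.
Proof.
move=> c0; apply/rowP=> i; have := c0 _ (ltn_ord i).
by rewrite /coord valK mxE.
Qed.

Lemma sum_sqr_eq0 k b : \sum_(j < k) b j ^+ 2 <= 0 ->
  forall j, (j < k)%N -> b j = 0.
Proof.
move=> sum_le0 j jk; apply/eqP; rewrite -sqrf_eq0 eq_le sqr_ge0 andbT.
rewrite (le_trans _ sum_le0) // (bigD1 (Ordinal jk)) //= lerDl.
by apply: sumr_ge0 => ? _; rewrite sqr_ge0.
Qed.

End PathVector.

(** * Eigenvalue bounds from a path of 3k vertices *)

Section LongPath.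
Variables (R : rcfType) (T : finType) (e : rel T).
Hypothesis e_tree : tree e.
Variables (a : T) (p : seq T) (k : nat).
Hypotheses (p_path : path e a p) (p_uniq : uniq (a :: p)).
Hypothesis size_p : (size p).+1 = (3 * k)%N.

Let e_sym : symmetric e. Proof. by case: e_tree => [[]]. Qed.

Let P : {set T} := [set v in a :: p].
Let vertex i := nth a (a :: p) i.

(** One value t serves every vertex off the path, since at most two of them enter the subtrees used
    below. *)
Definition spread (b : nat -> R) (s t : R) (v : T) : R :=
  if v \in P then path_vector b s (index v (a :: p)) else t.

Lemma spread_vertex b s t i : (i < 3 * k)%N ->
  spread b s t (vertex i) = path_vector b s i.
Proof.
by move=> ik; rewrite /spread inE mem_nth ?index_uniq //= size_p.
Qed.

Lemma spread_linear l b b' s s' t t' v :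
  spread (fun j => l * b j + b' j) (l * s + s') (l * t + t') v
  = l * spread b s t v + spread b' s' t' v.
Proof. by rewrite /spread; case: ifP => // _; exact: path_vector_linear. Qed.

Lemma eq_spread b b' s t v : b =1 b' -> spread b s t v = spread b' s t v.
Proof.
by move=> bb'; rewrite /spread (eq_path_vector _ _ bb').
Qed.

Lemma path_subtree : subtree e P.
Proof. by case: (lap_form_path e_tree (fun=> 0 : R) p_path p_uniq). Qed.

(** The form does not depend on s: that direction is free until a side vertex makes it negative. *)
Lemma lap_form_spread b s t :
  lap_form e P (spread b s t) = - 6 * \sum_(j < k) b j ^+ 2.
Proof.
have [_ ->] := lap_form_path e_tree (spread b s t) p_path p_uniq.
rewrite size_p (eq_bigr (fun i : 'I_(3 * k) => (path_vector b s i -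
  path_vector b s i.-1) ^+ 2
   - path_vector b s i ^+ 2)).
  by rewrite path_vector_form; ring.
move=> i _; rewrite -/(vertex i) -/(vertex i.-1) !spread_vertex //.
exact: leq_ltn_trans (leq_pred i) (ltn_ord i).
Qed.

Local Notation count := (eigenvalue_count (laplacian_mx e R) `[0%R, 1%R[).

Lemma eigenvalue_count_ge_path : (k <= count)%N.
Proof.
apply: (@eigenvalue_count_ge_subtree _ _ e_tree _ P a _
  (fun c => spread (coord c) 0 0)).
- exact: path_subtree.
- by rewrite inE mem_head.
- move=> l c d v; rewrite -spread_linear mulr0 addr0.
  by apply: eq_spread => j; rewrite coord_linear.
move=> c c0; rewrite lap_form_spread mulNr oppr_lt0 mulr_gt0 // lt0r sumr_ge0.
  rewrite andbT; apply: contraNneq c0 => s0; apply/eqP/coord_eq0/sum_sqr_eq0.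
  by rewrite s0.
by move=> j _; exact: sqr_ge0.
Qed.

(** Coordinate k plays the role of s, and u copies the value y of its neighbour, which adds - 2 y ^+
    2. If the form is not negative then all b_j and y vanish; since i is not 1 mod 3, y is then s up
    to sign. *)
Lemma eigenvalue_count_gt_side_vertex u i : u \notin P -> (i < 3 * k)%N ->
  (i %% 3 != 1)%N -> e u (vertex i) -> (k < count)%N.
Proof.
move=> uP ik i3 eui.
(* The value at i thus involves only b_0, ..., b_(k-1), never the coordinate k that is reused as
   s. *)
have i3k : (i.+1 %/ 3 <= k)%N by clear -ik; lia.
have iP : vertex i \in P by rewrite inE mem_nth //= size_p.
apply: (@eigenvalue_count_ge_subtree _ _ e_tree _ (u |: P) u _
  (fun c => spread (coord c) (coord c k) (path_vector (coord c) (coord c k)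
    i))).
- exact: subtreeU1 path_subtree iP eui.
- exact: setU11.
- move=> l c d v; rewrite -spread_linear -path_vector_linear -coord_linear.
  rewrite (eq_path_vector _ _ (coord_linear l c d)).
  exact: eq_spread (coord_linear l c d).
move=> c c0; rewrite (lap_formU1 e_tree _ path_subtree uP iP eui)
  lap_form_spread.
rewrite spread_vertex // {1 2}/spread (negbTE uP) subrr expr0n mulr0 addr0.
have S0 : 0 <= \sum_(j < k) coord c j ^+ 2 by apply: sumr_ge0 => ? _;
  exact: sqr_ge0.
have Y0 := sqr_ge0 (path_vector (coord c) (coord c k) i).
rewrite ltNge; apply: contraNN c0 => ge0.
have S_le0 : \sum_(j < k) coord c j ^+ 2 <= 0 by lra.
have Y_le0 : path_vector (coord c) (coord c k) i ^+ 2 <= 0 by lra.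
have b0 := sum_sqr_eq0 S_le0; apply/eqP/coord_eq0 => j.
rewrite ltnS leq_eqVlt => /predU1P[->|]; last exact: b0.
apply/eqP; rewrite -sqrf_eq0 eq_le sqr_ge0 andbT (le_trans _ Y_le0) //.
rewrite /path_vector (negbTE i3) alt_seq_sqr // => l li.
by apply: b0; exact: leq_trans li i3k.
Qed.

(** Coordinate k is the common value t of u and w, so the edge uw costs nothing, while s = 0. *)
Lemma eigenvalue_count_gt_side_edge u w j : u \notin P -> w \notin P ->
  u != w ->
  (j < k)%N -> e u (vertex (3 * j).+1) -> e w u -> (k < count)%N.
Proof.
move=> uP wP uw jk eui ewu.
have ik : ((3 * j).+1 < 3 * k)%N by lia.
have iP : vertex (3 * j).+1 \in P by rewrite inE mem_nth //= size_p.
have uPtree := subtreeU1 e_tree path_subtree iP eui.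
have uuP : u \in u |: P := setU11 _ _.
have wuP : w \notin u |: P by rewrite in_setU1 negb_or eq_sym uw.
apply: (@eigenvalue_count_ge_subtree _ _ e_tree _ (w |: (u |: P)) w _
  (fun c => spread (coord c) 0 (coord c k))).
- exact: subtreeU1 uPtree uuP ewu.
- exact: setU11.
- move=> l c d v; rewrite coord_linear -spread_linear mulr0 addr0.
  by apply: eq_spread => i; rewrite coord_linear.
move=> c c0.
rewrite (lap_formU1 e_tree _ uPtree wuP uuP ewu).
rewrite (lap_formU1 e_tree _ path_subtree uP iP eui) lap_form_spread.
rewrite spread_vertex // path_vector1 /spread (negbTE uP) (negbTE wP).
set sum := \sum_(_ < _) _; set t := coord c k; set b := coord c j.
have b_le : b ^+ 2 <= sum.
  rewrite /sum (bigD1 (Ordinal jk)) //= lerDl.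
  by apply: sumr_ge0 => ? _; exact: sqr_ge0.
have b2 := sqr_ge0 b; have bt2 := sqr_ge0 (t + b).
rewrite ltNge; apply: contraNN c0 => ge0.
(* Completing the square in t leaves 4 b ^+ 2, which - 6 * sum absorbs because b ^+ 2 <= sum. *)
have E : - 6 * sum + 2 * (t - b) ^+ 2 - 2 * t ^+ 2 + 2 * (t - t) ^+ 2
  - 2 * t ^+ 2 = - 6 * sum + 4 * b ^+ 2 - 2 * (t + b) ^+ 2 by ring.
rewrite {}E in ge0.
have S_le0 : sum <= 0 by lra.
have t_le0 : (t + b) ^+ 2 <= 0 by lra.
have b0 := sum_sqr_eq0 S_le0; apply/eqP/coord_eq0 => i.
rewrite ltnS leq_eqVlt => /predU1P[->|]; last exact: b0.
apply/eqP; rewrite -sqrf_eq0 eq_le sqr_ge0 andbT (le_trans _ t_le0) //.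
by rewrite (b0 _ jk : b = 0) addr0.
Qed.

Lemma domination_number_le_path : count = k -> (domination_number e <= k)%N.
Proof.
move=> countE.
pose D := [set vertex (3 * j).+1 | j : 'I_k].
have vD i : (i < 3 * k)%N -> (i %% 3 = 1)%N -> vertex i \in D.
  move=> ik i3; have jk : (i %/ 3 < k)%N by lia.
  have -> : i = (3 * Ordinal jk).+1 by rewrite /=; lia.
  exact: imset_f.
have cardD : (#|D| <= k)%N.
  by rewrite (leq_trans (leq_imset_card _ _)) // card_ord.
suff Ddom : dominating e D.
  rewrite /domination_number; case: arg_minnP => [|S Sdom Smin].
    by apply/forallP => x; rewrite inE.
  exact: leq_trans (Smin D Ddom) cardD.
(* With exactly k eigenvalues, branches can leave the path only at vertices of D. *)
have noside u i : u \notin P -> (i < 3 * k)%N -> e u (vertex i) ->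
  (i %% 3 = 1)%N.
  move=> uP ik eui; apply/eqP; apply/negPn/negP => i3.
  by have := eigenvalue_count_gt_side_vertex uP ik i3 eui; rewrite countE ltnn.
have edge i : (i.+1 < 3 * k)%N -> e (vertex i) (vertex i.+1).
  by rewrite -size_p ltnS => ip; exact: (pathP a p_path i ip).
have PE v : v \in P -> exists2 i, (i < 3 * k)%N & v = vertex i.
  rewrite inE => vP; exists (index v (a :: p)).
    by rewrite -size_p -[(size p).+1]/(size (a :: p)) index_mem.
  by rewrite /vertex nth_index.
apply/forallP=> w; apply/implyP=> wD; apply: contraT => /existsPn wnb.
have wN v : v \in D -> ~~ e w v by move=> vD'; have := wnb v; rewrite vD'.
(* On the path, a vertex of residue 0 has its successor in D, which exists as the length is a
   multiple of 3, and one of residue 2 has its predecessor in D. *)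
have wP : w \notin P.
  apply/negP => /PE[i ik wE]; subst w.
  have [i0|i1|i2] : [\/ (i %% 3 = 0)%N, (i %% 3 = 1)%N | (i %% 3 = 2)%N].
    have : (i %% 3 < 3)%N by rewrite ltn_mod.
    by case: (i %% 3)%N => [|[|[|//]]] _;
      [constructor 1 | constructor 2 | constructor 3].
  - have ik1 : (i.+1 < 3 * k)%N by lia.
    have /wN : vertex i.+1 \in D by apply: vD => //; lia.
    by rewrite edge.
  - by move: wD; rewrite vD.
  case: i i2 ik wN {wnb wD} => // i i2 ik wN.
  have /wN : vertex i \in D by apply: vD; lia.
  by rewrite e_sym edge.
(* A walk from a to the undominated w leaves S along some edge st. If s is on the path, t hangs from
   D, a contradiction; otherwise s and t form a pendant path of two edges at a vertex of D. *)
pose S := P :|: [set u | [exists v in D, e u v]].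
have wS : w \notin S.
  by rewrite in_setU negb_or wP inE; apply/existsPn => v; exact: wnb.
have aS : a \in S by rewrite !inE eqxx.
have [s [t [sS tS est]]] := boundary_edge e_tree aS wS.
move: tS; rewrite inE negb_or => /andP[tP tN].
have {}tN v : v \in D -> ~~ e t v.
  move=> vD'; apply: contra tN => etv; rewrite inE; apply/existsP.
  by exists v; rewrite vD'.
have [sP|sP] := boolP (s \in P).
  have [i ik sE] := PE s sP.
  have ets : e t (vertex i) by rewrite -sE e_sym.
  by have := tN _ (vD i ik (noside t i tP ik ets)); rewrite ets.
move: sS; rewrite inE (negbTE sP) inE => /existsP[_ /andP[/imsetP[j _ ->] esj]].
have st : s != t.
  by apply: contraTneq est => ->; case: e_tree => [[_ ->]].
have ets : e t s by rewrite e_sym.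
have := eigenvalue_count_gt_side_edge sP tP st (ltn_ord j) esj ets.
by rewrite countE ltnn.
Qed.

End LongPath.

(** * Diametral paths and the final equivalence *)

Lemma diameter_path (T : finType) (e : rel T) : tree e ->
  exists a p, [/\ path e a p, uniq (a :: p) & size p = diameter e].
Proof.
case=> _ [T_gt0 conn] _; rewrite /diameter.
have [a ->] := @bigop.eq_bigmax T (fun x => \max_(y : T) dist e x y)%N T_gt0.
have [b ->] := @bigop.eq_bigmax T (fun y => dist e a y) T_gt0.
have /connectP[p0 /shortenP[p p_path p_uniq _] bE] := conn a b.
have walk_p (q : seq T) : path e a q -> b = last a q ->
  walk_of_length e a b (size q).
  by move=> aq bq; apply/existsP; exists (in_tuple q); rewrite aq -bq /=.
have p_small (q : seq T) : uniq (a :: q) -> (size q < #|T|)%N.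
  by move/card_uniqP => /= <-; exact: max_card.
(* A simple path has fewer than #|T| edges, so the search succeeds and [dist] is not its default
   value. *)
have has_walk : has (walk_of_length e a b) (iota 0 #|T|).
  apply/hasP; exists (size p); last exact: walk_p.
  by rewrite mem_iota add0n p_small.
have dist_lt : (dist e a b < #|T|)%N.
  by move: has_walk; rewrite has_find size_iota.
have : walk_of_length e a b (dist e a b).
  by have := nth_find 0%N has_walk; rewrite nth_iota.
case/existsP=> q /andP[/shortenP[q' q'_path q'_uniq q'_sub] /eqP q'_last].
exists a, q'; split=> //; apply/eqP; rewrite eqn_leq; apply/andP; split.
  rewrite -[leqRHS](size_tuple q) uniq_leq_size //.
  by case/andP: q'_uniq.
(* A shorter simple path would be a walk found earlier by the search. *)
rewrite leqNgt; apply/negP => lt_q'.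
have := before_find 0%N lt_q'.
by rewrite nth_iota ?p_small // walk_p.
Qed.

Theorem theorem4 (R : rcfType) (T : finType) (e : rel T) (hT : tree e) :
  (domination_number e)%:R = (diameter e + 1)%:R / 3%:R :> rat <->
  (eigenvalue_count (laplacian_mx e R) `[0, 1[)%:R
    = (diameter e + 1)%:R / 3%:R :> rat.
Proof.
(* Both rational equations become d + 1 = 3n over the naturals, which supplies the k of the path
   lemmas. *)
have thirdE n : n%:R = (diameter e + 1)%:R / 3%:R :> rat <->
    (diameter e).+1 = (3 * n)%N.
  rewrite addn1; split=> [nE|->]; last by rewrite natrM mulrC mulKf.
  by apply/eqP; rewrite -(eqr_nat rat) natrM nE mulrC divfK.
have e_sym : symmetric e by case: hT => [[]].
have [a [p [p_path p_uniq size_p]]] := diameter_path hT.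
have count_le : (eigenvalue_count (laplacian_mx e R) `[0%R, 1%R[
    <= domination_number e)%N.
  rewrite /domination_number; case: arg_minnP => [|S Sdom _].
    by apply/forallP => x; rewrite inE.
  exact: eigenvalue_count_le_dominating.
(* In the first direction k is the domination number, in the second it is the eigenvalue count. *)
rewrite !thirdE -size_p; split=> [gE|mE].
  have ge := eigenvalue_count_ge_path R hT p_path p_uniq gE.
  by rewrite gE; congr muln; apply/eqP; rewrite eqn_leq ge.
have le := domination_number_le_path (R := R) hT p_path p_uniq mE erefl.
by rewrite mE; congr muln; apply/eqP; rewrite eqn_leq count_le.
Qed.
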